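(* For every integer $k\geq 1$ and every finite generating set $X$ of the free inverse monoid $\mathrm{FIM}_k$ of rank $k$, neither the word problem $\mathrm{WP}(\mathrm{FIM}_k,X)$ nor the two-tape word problem $\iota(\mathrm{FIM}_k,X)$ is context-free.
   Context: A monoid $M$ is inverse if for every $x\in M$ there is a unique $y\in M$ (the inverse $x^{-1}$ of $x$) with $xyx=x$ and $yxy=y$. For a set $X$, let $X^{-1}=\{\overline{x}\mid x\in X\}$ be a disjoint set of formal inverses and $X^{\pm}=X\cup X^{-1}$; put $x^{-1}=\overline{x}$ and $\overline{x}^{-1}=x$ for $x\in X$, and for a word $w=w_1\cdots w_n$ with $w_i\in X^{\pm}$ put $w^{\mathrm{inv}}=w_n^{-1}\cdots w_1^{-1}$. The free inverse monoid $\mathrm{FIM}(X)$ is the free object on $X$ in the variety of inverse monoids, i.e. the quotient of $(X^{\pm})^*$ by the relations $u=uu^{\mathrm{inv}}u$ and $uu^{\mathrm{inv}}vv^{\mathrm{inv}}=vv^{\mathrm{inv}}uu^{\mathrm{inv}}$ for $u,v\in (X^{\pm})^*$. If $|X|=k$ it is denoted $\mathrm{FIM}_k$. If $M$ is an inverse monoid and $X\subseteq M$ is a finite set generating $M$ as an inverse monoid, words over $X^{\pm}$ are evaluated in $M$ by interpreting $\overline{x}$ as the inverse of $x$, and $u=_M v$ means that $u$ and $v$ represent the same element of $M$. With $\#$ a symbol not in $X^{\pm}$, $$\mathrm{WP}(M,X)=\{u\#v^{\mathrm{inv}}\mid u,v\in (X^{\pm})^*,\ u=_M v\},$$ $$\iota(M,X)=\{(u,v)\in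 (X^{\pm})^*\times (X^{\pm})^*\mid u=_M v\}.$$ A relation $R\subseteq A^*\times A^*$ ($A$ a finite alphabet) is called context-free if it is accepted by a nondeterministic two-tape pushdown automaton (one stack, two one-way input tapes read asynchronously); equivalently, if $R$ is the image of a context-free language over the alphabet $\{(a,\varepsilon),(\varepsilon,a)\mid a\in A\}$ under the natural homomorphism to $A^*\times A^*$. *)

(* Defs.v *)
From HB Require Import structures.
From mathcomp Require Import all_boot finmap generic_quotient.
From mathcomp Require Import boolp.

Set Implicit Arguments.
Unset Strict Implicit.
Unset Printing Implicit Defensive.

Local Open Scope group_scope.
Local Open Scope quotient_scope.

(* The letter x is (x, false) and its formal inverse is (x, true). *)
Notation signed X := (X * bool)%type.

Definition linv (X : Type) (a : signed X) : signed X := (a.1, ~~ a.2).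

Definition winv (X : Type) (w : seq (signed X)) : seq (signed X) :=
  rev (map (@linv X) w).

(* Every x has y = x^-1 as its unique inverse.  The involution axioms of a
   starMonoidType, x^-1^-1 = x and (x * y)^-1 = y^-1 * x^-1, hold in every
   inverse monoid, so building on that structure loses no generality. *)
HB.mixin Record StarMonoid_isInverseMonoid M of StarMonoid M := {
  inverseP : forall x y : M,
    (x * y * x = x /\ y * x * y = y) <-> y = x^-1
}.

#[short(type="inverseMonoidType")]
HB.structure Definition InverseMonoid :=
  {M of StarMonoid M & StarMonoid_isInverseMonoid M}.

Definition leval (X : Type) (M : inverseMonoidType) (f : X -> M)
  (a : signed X) : M := if a.2 then (f a.1)^-1 else f a.1.

Definition weval (X : Type) (M : inverseMonoidType) (f : X -> M)
  (w : seq (signed X)) : M := foldr (fun a m => leval f a * m) 1 w.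

Definition generates (M : inverseMonoidType) (X : {fset M}) : Prop :=
  forall m : M, exists w : seq (signed X), weval val w = m.

Inductive fim_cong (X : Type) :
  seq (signed X) -> seq (signed X) -> Prop :=
| FimReg u : fim_cong u (u ++ winv u ++ u)
| FimComm u v :
    fim_cong (u ++ winv u ++ v ++ winv v) (v ++ winv v ++ u ++ winv u)
| FimRefl u : fim_cong u u
| FimSym u v : fim_cong u v -> fim_cong v u
| FimTrans u v w : fim_cong u v -> fim_cong v w -> fim_cong u w
| FimCat u u' v v' :
    fim_cong u u' -> fim_cong v v' -> fim_cong (u ++ v) (u' ++ v').

Section FreeInverseMonoid.
Variable X : choiceType.
Implicit Types u v w : seq (signed X).

Definition fim_rel u v : bool := `[< fim_cong u v >].

Lemma fim_rel_refl : reflexive fim_rel.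
Proof. by move=> u; apply/asboolP; exact: FimRefl. Qed.

Lemma fim_rel_sym : symmetric fim_rel.
Proof. by move=> u v; apply/asboolP/asboolP; exact: FimSym. Qed.

Lemma fim_rel_trans : transitive fim_rel.
Proof.
move=> v u w /asboolP uv /asboolP vw; apply/asboolP; exact: FimTrans uv vw.
Qed.

Canonical fim_equiv := EquivRel fim_rel fim_rel_refl fim_rel_sym fim_rel_trans.

Definition FIM : Type := {eq_quot fim_equiv}.

HB.instance Definition _ := Choice.on FIM.
HB.instance Definition _ := EqQuotient.on FIM.

Lemma FIM_eqP u v : \pi_FIM u = \pi_FIM v <-> fim_cong u v.
Proof.
split; first by move/eqmodP => /asboolP.
by move=> uv; apply/eqmodP/asboolP.
Qed.

Lemma FIM_piP (a : FIM) : exists u, a = \pi_FIM u.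
Proof. by exists (repr a); rewrite reprK. Qed.

Lemma winvK : involutive (@winv X).
Proof.
move=> w; rewrite /winv map_rev revK -map_comp map_id_in //.
by move=> [x b] _; rewrite /= /linv /= negbK.
Qed.

Lemma winv_cat u v : winv (u ++ v) = winv v ++ winv u.
Proof. by rewrite /winv map_cat rev_cat. Qed.

Lemma fim_cong_winv u v : fim_cong u v -> fim_cong (winv u) (winv v).
Proof.
elim=> {u v} [u|u v|u|u v _|u v w _ uv _|u u' v v' _ uu' _ vv'].
- by have := FimReg (winv u); rewrite !winv_cat winvK catA.
- rewrite !winv_cat !winvK -!catA; exact: FimComm.
- exact: FimRefl.
- exact: FimSym.
- exact: FimTrans.
- by rewrite !winv_cat; apply: FimCat.
Qed.

Definition fim_mul (a b : FIM) : FIM := \pi_FIM (repr a ++ repr b).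
Definition fim_one : FIM := \pi_FIM [::].
Definition fim_inv (a : FIM) : FIM := \pi_FIM (winv (repr a)).

Lemma fim_reprP u : fim_cong (repr (\pi_FIM u)) u.
Proof. by apply/FIM_eqP; rewrite reprK. Qed.

Lemma pi_fim_mul u v : fim_mul (\pi_FIM u) (\pi_FIM v) = \pi_FIM (u ++ v).
Proof. by apply/FIM_eqP; apply: FimCat; exact: fim_reprP. Qed.

Lemma pi_fim_inv u : fim_inv (\pi_FIM u) = \pi_FIM (winv u).
Proof. by apply/FIM_eqP; apply: fim_cong_winv; exact: fim_reprP. Qed.

Lemma fim_mulA : associative fim_mul.
Proof.
move=> a b c; have [u ->] := FIM_piP a; have [v ->] := FIM_piP b; have [w ->] := FIM_piP c.
by rewrite !pi_fim_mul catA.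
Qed.

Lemma fim_mul1 : left_id fim_one fim_mul.
Proof. by move=> a; have [u ->] := FIM_piP a; rewrite pi_fim_mul. Qed.

Lemma fim_mulr1 : right_id fim_one fim_mul.
Proof. by move=> a; have [u ->] := FIM_piP a; rewrite pi_fim_mul cats0. Qed.

HB.instance Definition _ := isMonoid.Build FIM fim_mulA fim_mul1 fim_mulr1.
HB.instance Definition _ := hasInv.Build FIM fim_inv.

Lemma FIM_piM u v : \pi_FIM u * \pi_FIM v = \pi_FIM (u ++ v).
Proof. exact: pi_fim_mul. Qed.

Lemma FIM_piV u : (\pi_FIM u)^-1 = \pi_FIM (winv u).
Proof. exact: pi_fim_inv. Qed.

Lemma fim_regular (a : FIM) : a * a^-1 * a = a.
Proof.
have [u ->] := FIM_piP a.
rewrite FIM_piV !FIM_piM.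
by apply/FIM_eqP; apply: FimSym; rewrite -catA; exact: FimReg.
Qed.

Lemma fim_invK (a : FIM) : a^-1^-1 = a.
Proof. by have [u ->] := FIM_piP a; rewrite !FIM_piV winvK. Qed.

Lemma fim_invM (a b : FIM) : (a * b)^-1 = b^-1 * a^-1.
Proof.
have [u ->] := FIM_piP a; have [v ->] := FIM_piP b.
by rewrite FIM_piM !FIM_piV FIM_piM winv_cat.
Qed.

HB.instance Definition _ := Monoid_isStarMonoid.Build FIM fim_invK fim_invM.

Lemma fim_comm (a b : FIM) : a * a^-1 * (b * b^-1) = b * b^-1 * (a * a^-1).
Proof.
have [u ->] := FIM_piP a; have [v ->] := FIM_piP b.
rewrite !FIM_piV !FIM_piM.
by apply/FIM_eqP; rewrite -!catA; exact: FimComm.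
Qed.

Lemma fim_idem_inv (e : FIM) : e * e = e -> e^-1 = e.
Proof.
move=> ee; have ff : e^-1 * e^-1 = e^-1 by rewrite -fim_invM ee.
have fef : e^-1 * e * e^-1 = e^-1.
  by have := fim_regular e^-1; rewrite fim_invK.
have := fim_comm e^-1 e; rewrite fim_invK.
have -> : e^-1 * e * (e * e^-1) = e^-1.
  by rewrite mulgA -(mulgA e^-1 e e) ee fef.
by rewrite mulgA -(mulgA e e^-1 e^-1) ff fim_regular.
Qed.

Lemma fim_idem_comm (e f : FIM) : e * e = e -> f * f = f -> e * f = f * e.
Proof.
move=> ee ff; have := fim_comm e f.
by rewrite !fim_idem_inv // ee ff.
Qed.

Lemma fim_inverseP (x y : FIM) :
  (x * y * x = x /\ y * x * y = y) <-> y = x^-1.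
Proof.
split=> [[xyx yxy]|->]; last first.
  by split; [exact: fim_regular | have := fim_regular x^-1; rewrite fim_invK].
set z := x^-1.
have xzx : x * z * x = x by exact: fim_regular.
have zxz : z * x * z = z by have := fim_regular z; rewrite fim_invK.
have idl (t : FIM) : x * t * x = x -> (x * t) * (x * t) = x * t.
  by move=> e; rewrite mulgA e.
have idr (t : FIM) : x * t * x = x -> (t * x) * (t * x) = t * x.
  by move=> e; rewrite -mulgA (mulgA x) e.
have -> : y = z * x * y.
  rewrite -{1}yxy -{1}xzx -!mulgA 2!(mulgA _ x) (mulgA (y * x)).
  rewrite (fim_idem_comm (idr _ xyx) (idr _ xzx)).
  by rewrite -!mulgA (mulgA y x) yxy.
rewrite -{2}zxz -{1}xzx -!mulgA (mulgA x z) (mulgA z).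
rewrite (fim_idem_comm (idl _ xzx) (idl _ xyx)).
by rewrite -!mulgA (mulgA x y) (mulgA (x * y)) xyx.
Qed.

HB.instance Definition _ := StarMonoid_isInverseMonoid.Build FIM fim_inverseP.

End FreeInverseMonoid.

Record cfg (T : finType) := CFG {
  nonterm : finType;
  start : nonterm;
  prods : seq (nonterm * seq (nonterm + T))
}.

Section Cfg.
Variables (T : finType) (G : cfg T).

Inductive derives : seq (nonterm G + T) -> seq (nonterm G + T) -> Prop :=
| DerRefl s : derives s s
| DerStep (p q : seq (nonterm G + T)) A rhs s :
    (A, rhs) \in prods G -> derives (p ++ rhs ++ q) s ->
    derives (p ++ inl A :: q) s.

Definition cfg_lang (w : seq T) : Prop := derives [:: inl (start G)] (map inr w).

End Cfg.

Definition context_free (T : finType) (L : seq T -> Prop) : Prop :=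
  exists G : cfg T, forall w, L w <-> cfg_lang G w.

(* The letter inl a stands for (a, epsilon) and inr a for (epsilon, a). *)
Fixpoint tapes (A : Type) (w : seq (A + A)) : seq A * seq A :=
  match w with
  | [::] => ([::], [::])
  | inl a :: w' => (a :: (tapes w').1, (tapes w').2)
  | inr a :: w' => ((tapes w').1, a :: (tapes w').2)
  end.

(* R is the image of a context-free language under the natural homomorphism
   [tapes]; equivalently, R is accepted by a two-tape pushdown automaton. *)
Definition context_free_rel (A : finType) (R : seq A -> seq A -> Prop) : Prop :=
  exists2 L : seq (A + A) -> Prop, context_free L &
    forall u v, R u v <-> exists2 w, L w & tapes w = (u, v).

(* The symbol # is None. *)
Definition WP (M : inverseMonoidType) (X : {fset M})
    (w : seq (option (signed X))) : Prop :=
  exists u v : seq (signed X),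
    weval val u = weval val v /\
    w = map Some u ++ None :: map Some (winv v).

Definition two_tape_WP (M : inverseMonoidType) (X : {fset M})
    (u v : seq (signed X)) : Prop := weval val u = weval val v.

(* Main.v *)
Require Import Defs.
From mathcomp Require Import all_boot finmap generic_quotient zify.

(* Letting words act by partial injections on the edge between 1 and x of the
   Cayley graph of the free group shows that every generating set contains x or
   x^-1.  In FIM put U = x^n x^-2n and V = x^-n x^2n x^-2n x^2n x^-2n, so that
   U = V.  Colouring the positions of a word by the blocks they lie in, the
   pumping lemma can be arranged so that each pumped factor stays within a block
   of U and a block of V: pumping only changes block lengths, those of at most
   two blocks of V.  Pumping down and up once must both preserve U = V, so V has
   to stay within the range of heights visited by U both times.  This forces
   both peaks of V to move exactly like the single peak of U, and then the
   valleys to stay put, so that nothing was pumped at all. *)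

Set Implicit Arguments.
Unset Strict Implicit.
Unset Printing Implicit Defensive.

(** * A pumping lemma with coloured positions *)

Section Pumping.
Variables (T : finType) (G : cfg T).
Local Notation sform := (seq (nonterm G + T)).
Implicit Types (A B : nonterm G) (s : sform) (u v w : seq T).

Local Notation terminals := (map (@inr (nonterm G) T)).

Lemma derives_trans s1 s2 s3 : derives s1 s2 -> derives s2 s3 -> derives s1 s3.
Proof.
elim=> {s1 s2} // p q A rhs s prodA _ IH /IH.
exact: DerStep prodA.
Qed.

Lemma derives_cat2 (p q s1 s2 : sform) :
  derives s1 s2 -> derives (p ++ s1 ++ q) (p ++ s2 ++ q).
Proof.
elim=> {s1 s2} [s|p' q' A rhs s prodA _ IH]; first exact: DerRefl.
move: IH; rewrite -!catA !cat_cons => IH; rewrite catA.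
by apply: DerStep prodA _; rewrite -catA.
Qed.

Lemma derives_cat (s1 s1' s2 s2' : sform) :
  derives s1 s1' -> derives s2 s2' -> derives (s1 ++ s2) (s1' ++ s2').
Proof.
move=> d1 d2; apply: (@derives_trans _ (s1' ++ s2)).
  exact: (derives_cat2 [::] s2 d1).
by have := derives_cat2 s1' [::] d2; rewrite !cats0.
Qed.

Lemma derives_prod A rhs s :
  (A, rhs) \in prods G -> derives rhs s -> derives [:: inl A] s.
Proof.
by move=> prodA d; apply: (@DerStep _ _ [::] [::] A rhs s prodA); rewrite cats0.
Qed.

(* [n] is the number of productions used in the parse forest of [w]. *)
Inductive yields : nat -> sform -> seq T -> Prop :=
| YieldsNil : yields 0 [::] [::]
| YieldsTerm n t s w : yields n s w -> yields n (inr t :: s) (t :: w)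
| YieldsProd m n A rhs s v w : (A, rhs) \in prods G ->
    yields m rhs v -> yields n s w -> yields (m + n).+1 (inl A :: s) (v ++ w).

Lemma yields_derives n s w : yields n s w -> derives s (terminals w).
Proof.
elim=> {n s w} [|n t s w _ IH|m n A rhs s v w prodA _ IHv _ IHw].
- exact: DerRefl.
- by rewrite -cat1s map_cons -[inr t :: map _ _]cat1s; apply/derives_cat/IH/DerRefl.
- by rewrite -cat1s map_cat; apply/derives_cat/IHw/derives_prod/IHv.
Qed.

Lemma yields_cat_inv n s1 s2 w : yields n (s1 ++ s2) w ->
  exists n1 n2 w1 w2,
    [/\ w = w1 ++ w2, yields n1 s1 w1 & yields n2 s2 w2].
Proof.
elim: s1 n w => [|x s1 IH] n w /= y.
  by exists 0, n, [::], w; split=> //; exact: YieldsNil.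
inversion y as [|n' t s w' y'|m n' A rhs s v w' prodA y1 y2]; subst.
  have [n1 [n2 [w1 [w2 [-> y1 y2]]]]] := IH _ _ y'.
  by exists n1, n2, (t :: w1), w2; split=> //; exact: YieldsTerm.
have [n1 [n2 [w1 [w2 [-> y3 y4]]]]] := IH _ _ y2.
exists (m + n1).+1, n2, (v ++ w1), w2; rewrite catA; split=> //.
exact: YieldsProd prodA _ _.
Qed.

Lemma yields_cat n1 n2 s1 s2 w1 w2 : yields n1 s1 w1 -> yields n2 s2 w2 ->
  exists n, yields n (s1 ++ s2) (w1 ++ w2).
Proof.
move=> y1 y2.
elim: y1 => {n1 s1 w1} [|n t s w _ [n' IH]|m n A rhs s v w prodA yv _ _ [n' IH]].
- by exists n2.
- by exists n'; exact: YieldsTerm.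
- by exists (m + n').+1; rewrite -catA; exact: YieldsProd prodA _ _.
Qed.

Lemma yields_terminals w : yields 0 (terminals w) w.
Proof. by elim: w => [|t w IH]; constructor. Qed.

(** A derivation is read backwards: undoing its first production regroups the trees above [rhs]
    under one new node. *)
Lemma derives_yields s w : derives s (terminals w) -> exists n, yields n s w.
Proof.
move E: (terminals w) => s' d; elim: d E => {s s'} [s <-|p q A rhs s prodA _ IH].
  by exists 0; exact: yields_terminals.
move=> /IH [n /yields_cat_inv [n1 [n2 [w1 [w2 [-> y1]]]]]].
move=> /yields_cat_inv [n3 [n4 [w3 [w4 [-> y3 y4]]]]].
exact: yields_cat y1 (YieldsProd prodA y3 y4).
Qed.

(** Pigeonhole: otherwise each symbol of [s] would contribute at most [b] letters, a terminal
    contributing only one. The bound [m < n] drives the induction along a path of the parse tree. *)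
Lemma yields_large_child n s w b : yields n s w -> 0 < b -> size s * b < size w ->
  exists m A rhs s1 s2 w1 w0 w2,
    [/\ s = s1 ++ inl A :: s2, w = w1 ++ w0 ++ w2, (A, rhs) \in prods G
      & [/\ yields m rhs w0, m < n, b < size w0,
           derives s1 (terminals w1) & derives s2 (terminals w2)]].
Proof.
move=> y b0; elim: y => {n s w} [|n t s w _ IH|m n A rhs s v w prodA yv _ yw IH] //=.
  rewrite mulSn => lt; case: IH => [|m [A [rhs [s1 [s2 [w1 [w0 [w2]]]]]]]]; first lia.
  move=> [-> -> prodA [yr mn bw d1 d2]].
  exists m, A, rhs, (inr t :: s1), s2, (t :: w1), w0, w2.
  do ![split=> //]; rewrite /= -cat1s -[inr t :: map _ _]cat1s.
  exact/derives_cat/d1/DerRefl.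
rewrite size_cat mulSn => lt.
case: (ltnP b (size v)) => [bv|vb].
  exists m, A, rhs, [::], s, [::], v, w; do ![split=> //]; first by lia.
    exact: DerRefl.
  exact: yields_derives yw.
case: IH => [|m' [A' [rhs' [s1 [s2 [w1 [w0 [w2]]]]]]]]; first lia.
move=> [-> -> prodA' [yr mn bw d1 d2]].
exists m', A', rhs', (inl A :: s1), s2, (v ++ w1), w0, w2.
rewrite -!catA; do ![split=> //]; first by lia.
rewrite -cat1s map_cat; apply/derives_cat/d1.
exact/derives_prod/(yields_derives yv).
Qed.

Definition derives_around A u B v :=
  derives [:: inl A] (terminals u ++ inl B :: terminals v).

Lemma derives_around_trans A u B v C u' v' : derives_around A u B v ->
  derives_around B u' C v' -> derives_around A (u ++ u') C (v' ++ v).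
Proof.
move=> d d'; apply: derives_trans d _.
have := derives_cat2 (terminals u) (terminals v) d'.
by rewrite !map_cat -!catA.
Qed.

Lemma derives_around_word A u B v w : derives_around A u B v ->
  derives [:: inl B] (terminals w) -> derives [:: inl A] (terminals (u ++ w ++ v)).
Proof.
move=> d d'; apply: derives_trans d _; rewrite !map_cat.
exact: (derives_cat2 (terminals u) (terminals v) d').
Qed.

Lemma derives_around_prod A B s1 s2 w1 w2 : (A, s1 ++ inl B :: s2) \in prods G ->
  derives s1 (terminals w1) -> derives s2 (terminals w2) ->
  derives_around A w1 B w2.
Proof.
move=> prodA d1 d2; apply: (derives_prod prodA); apply: derives_cat d1 _.
by rewrite -cat1s -[inl B :: map _ _]cat1s; apply/derives_cat/d2/DerRefl.
Qed.

Variables (C : finType) (c : nat -> C).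

(** In place of the classical length bound on [b ++ m ++ d], the two ends of each pumped factor
    share a colour. Only the exponents 0 and 2 are recorded. *)
Definition pumpable w := exists a b m d e : seq T,
  [/\ w = a ++ b ++ m ++ d ++ e, 0 < size (b ++ d),
      c (size a) = c (size (a ++ b)),
      c (size (a ++ b ++ m)) = c (size (a ++ b ++ m ++ d))
    & cfg_lang G (a ++ m ++ e) /\
      cfg_lang G (a ++ b ++ b ++ m ++ d ++ d ++ e)].

Definition max_rhs := \max_(p <- prods G) size p.2.

(* [F] records the colours of the ancestors whose yield is strictly larger than
   that of the current node; each descent to the largest child either keeps
   the yield or spends a new colour. *)
Lemma pumpable_descent n (F : {set nonterm G * C * C}) A rhs a w e :
  (A, rhs) \in prods G -> yields n rhs w ->
  derives_around (start G) a A e ->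
  (forall f, f \in F -> exists a1 a2 e2 e1,
     [/\ a = a1 ++ a2, e = e2 ++ e1, 0 < size (a2 ++ e2),
         derives_around (start G) a1 f.1.1 e1 /\ derives_around f.1.1 a2 A e2
       & c (size a1) = f.1.2 /\ c (size (a1 ++ a2 ++ w ++ e2)) = f.2]) ->
  max_rhs.+1 ^ #|~: F| < size w -> pumpable (a ++ w ++ e).
Proof.
elim/ltn_ind: n F A rhs a w e => n IH F A rhs a w e prodA yw ctxA ctxF large.
(* If the triple is in [F], then [A] recurs on the path with the same colours at both ends of its
   yield, and the piece of path between the two occurrences can be removed or doubled. *)
have [inF|notF] := boolP ((A, c (size a), c (size (a ++ w))) \in F).
  have [a1 [a2 [e2 [e1 [ea ee nz /= [d1 d2] [c1 c2]]]]]] := ctxF _ inF.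
  have dA : derives [:: inl A] (terminals w).
    exact: derives_prod prodA (yields_derives yw).
  exists a1, a2, w, e2, e1; split=> //.
  - by rewrite ea ee -!catA.
  - by rewrite c1 ea.
  - by rewrite c2 catA ea.
  - split; first exact: derives_around_word d1 dA.
    have := derives_around_word (derives_around_trans (derives_around_trans d1 d2) d2) dA.
    by rewrite -!catA.
have card_F : #|~: F| = #|~: ((A, c (size a), c (size (a ++ w))) |: F)|.+1.
  have := cardsC F; have := cardsC ((A, c (size a), c (size (a ++ w))) |: F).
  by rewrite cardsU1 notF add1n addSnnS => <- /addnI.
have rhs_le : size rhs <= max_rhs.
  by rewrite /max_rhs (big_rem _ prodA) /= leq_maxl.
have b0 k : 0 < max_rhs.+1 ^ k by rewrite expn_gt0.
have := large; rewrite card_F expnS => large'.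
have [|m [B [rhs' [s1 [s2 [w1 [w0 [w2 [erhs ew prodB [yw0 mn big d1 d2]]]]]]]]]] :=
  yields_large_child yw (b0 #|~: ((A, c (size a), c (size (a ++ w))) |: F)|).
  apply: leq_ltn_trans large'; rewrite leq_mul2r; apply/orP; right; exact: leqW.
have ctxB : derives_around A w1 B w2.
  by apply: derives_around_prod d1 d2; rewrite -erhs.
have -> : a ++ w ++ e = (a ++ w1) ++ w0 ++ w2 ++ e by rewrite ew -!catA.
have ctxF' f : f \in F -> exists a1 a2 e2 e1,
     [/\ a ++ w1 = a1 ++ a2, w2 ++ e = e2 ++ e1, 0 < size (a2 ++ e2),
         derives_around (start G) a1 f.1.1 e1 /\ derives_around f.1.1 a2 B e2
       & c (size a1) = f.1.2 /\ c (size (a1 ++ a2 ++ w0 ++ e2)) = f.2].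
  move=> /ctxF [a1 [a2 [e2 [e1 [-> -> nz [d3 d4] [c1 c2]]]]]].
  exists a1, (a2 ++ w1), (w2 ++ e2), e1; rewrite -!catA; split=> //.
  - move: nz; rewrite !size_cat; lia.
  - by split=> //; exact: derives_around_trans d4 ctxB.
  - by rewrite -c2 ew -!catA.
have ctx_start : derives_around (start G) (a ++ w1) B (w2 ++ e).
  exact: derives_around_trans ctxA ctxB.
(* The triple of [A] may enter [F] only if letters are lost on the way to [B]: otherwise a later
   repetition could pump empty factors. *)
have [same|less] := leqP (size w) (size w0).
  by apply: (IH m mn F B rhs') => //; exact: leq_trans large same.
apply: (IH m mn ((A, c (size a), c (size (a ++ w))) |: F) B rhs') => //.
move=> f; rewrite !inE => /orP [/eqP ->|]; last exact: ctxF'.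
exists a, w1, w2, e; split=> //.
- move: less; rewrite ew !size_cat; lia.
- by rewrite /= ew.
Qed.

Lemma pumping w : max_rhs.+1 ^ #|{: nonterm G * C * C}| < size w ->
  cfg_lang G w -> pumpable w.
Proof.
move=> large /derives_yields [n yw].
inversion yw as [| |m n' A rhs s v w' prodA yv yn]; subst.
inversion yn; subst; move: large; rewrite cats0 => large.
have := @pumpable_descent m set0 (start G) rhs [::] v [::] prodA yv; rewrite cats0 => H.
by apply: H => [|f|]; [exact: DerRefl | rewrite inE | rewrite setC0 cardsT].
Qed.

End Pumping.

(** * Words as sequences of blocks, and the effect of pumping inside blocks *)

(* A list of pairs (n, x) stands for the word of the blocks x^n. *)
Section Blocks.
Variable T : Type.
Implicit Types (bs : seq (nat * T)) (u v : seq T).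

Definition blocks bs : seq T := flatten [seq nseq b.1 b.2 | b <- bs].

Lemma blocks_cons n x bs : blocks ((n, x) :: bs) = nseq n x ++ blocks bs.
Proof. by []. Qed.

(** A boundary position belongs to the block on its right, and the end of the word gets the index
    [size bs]; so there is one more index than there are blocks. *)
Fixpoint block_index bs p :=
  if bs is b :: bs' then if p < b.1 then 0 else (block_index bs' (p - b.1)).+1
  else 0.

Definition resize (op : nat -> nat -> nat) bs ss :=
  [seq (op p.1.1 p.2, p.1.2) | p <- zip bs ss].

Lemma block_index_le bs p : block_index bs p <= size bs.
Proof. by elim: bs p => //= b bs IH p; case: ifP => // _; exact: IH. Qed.

Lemma block_index_nseq_cat n x bs u :
  block_index ((n, x) :: bs) (size (nseq n x ++ u)) = (block_index bs (size u)).+1.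
Proof. by rewrite size_cat size_nseq /= ltnNge leq_addr addKn. Qed.

Lemma resize_cons op n x bs s ss :
  resize op ((n, x) :: bs) (s :: ss) = (op n s, x) :: resize op bs ss.
Proof. by []. Qed.

Lemma resize0 op bs : right_id 0 op -> resize op bs (nseq (size bs) 0) = bs.
Proof. by move=> op0; elim: bs => //= -[n x] bs IH; rewrite resize_cons op0 IH. Qed.

Lemma nseq_cat_le n x v a r : nseq n x ++ v = a ++ r -> size a <= n ->
  exists2 p, a = nseq p x & nseq (n - p) x ++ v = r.
Proof.
elim: a n => [|y a IH] n; first by move=> /= <-; exists 0; rewrite ?subn0.
by case: n => //= n [<- /IH e] /e [p -> <-]; exists p.+1.
Qed.

Lemma nseq_cat_ge n x v a r : nseq n x ++ v = a ++ r -> n <= size a ->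
  exists2 a', a = nseq n x ++ a' & v = a' ++ r.
Proof.
elim: n a => [|n IH] [|y a] //=; try by exists [::].
  by move=> ->; exists (y :: a).
by move=> [<- /IH e] /e [a' -> ->]; exists a'.
Qed.

(** Since both ends of [b] lie in one block, [b] is a power of the letter of that block, and
    likewise [d]. Removing or doubling them changes only block lengths, and [ss] records by how
    much. *)
Lemma blocks_pump bs a b m d e : blocks bs = a ++ b ++ m ++ d ++ e ->
  block_index bs (size a) = block_index bs (size (a ++ b)) ->
  block_index bs (size (a ++ b ++ m)) = block_index bs (size (a ++ b ++ m ++ d)) ->
  exists ss : seq nat,
    [/\ size ss = size bs, sumn ss = size (b ++ d),
        count (fun s => 0 < s) ss <= (0 < size b) + (0 < size d),
        all2 (fun b s => s <= b.1) bs ss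
      & a ++ m ++ e = blocks (resize subn bs ss) /\
        a ++ b ++ b ++ m ++ d ++ d ++ e = blocks (resize addn bs ss)].
Proof.
elim: bs a b m d e => [|[l x] bs IH] a b m d e.
  case: a => //; case: b => //; case: m => //; case: d => //; case: e => // _ _ _.
  by exists [::].
rewrite blocks_cons; have [la|al] := leqP l (size a).
  move=> /nseq_cat_ge /(_ la) [a' -> /IH {}IH]; rewrite -!catA.
  rewrite !block_index_nseq_cat => -[/IH {}IH] [/IH [ss [s1 s2 s3 s4 [s5 s6]]]].
  exists (0 :: ss); rewrite /= s1 s2; split=> //.
  by rewrite !resize_cons subn0 addn0 !blocks_cons s5 s6.
have index_lt p : p < l -> block_index ((l, x) :: bs) p = 0 by move=> /= ->.
have lt_index p : block_index ((l, x) :: bs) p = 0 -> p < l by move=> /=; case: ifP.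
move=> /nseq_cat_le /(_ (ltnW al)) [p ea eqb]; subst a.
move: al; rewrite size_nseq => pl; rewrite (index_lt _ pl).
move=> /esym /lt_index; rewrite size_cat size_nseq => bl.
have [|q eb eqm] := nseq_cat_le eqb; first by lia.
subst b; move: bl; rewrite size_nseq => ql.
(* Here [b] lies in the first block; [d] starts either in that block too, or beyond it. *)
have [ml|lm] := ltnP (size (nseq p x ++ nseq q x ++ m)) l.
  rewrite (index_lt _ ml) => /esym /lt_index; move: ml.
  rewrite !size_cat !size_nseq => ml dl.
  have [|r em eqd] := nseq_cat_le eqm; first by lia.
  subst m; move: ml dl; rewrite size_nseq => ml dl.
  have [|t ed ee] := nseq_cat_le eqd; first by lia.
  subst d; move: dl; rewrite size_nseq => dl.
  exists (q + t :: nseq (size bs) 0); rewrite /= !size_nseq; split=> //.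
  - by rewrite sumn_nseq mul0n addn0.
  - by rewrite count_nseq /= addn0; lia.
  - by apply/andP; split; [lia | elim: (bs)].
  - rewrite !resize_cons (resize0 _ subn0) (resize0 _ addn0) !blocks_cons.
    rewrite -ee !catA -!nseqD; split; congr (nseq _ _ ++ _); lia.
move=> mdl; have [|m' em eqd] := nseq_cat_ge eqm.
  by move: lm; rewrite !size_cat !size_nseq; lia.
subst m; set r := l - p - q in eqd mdl *.
have lE : l = p + q + r by lia.
have cat3 u : nseq p x ++ nseq q x ++ nseq r x ++ u = nseq l x ++ u.
  by rewrite lE !nseqD -!catA.
move: mdl; rewrite -!catA !cat3 !block_index_nseq_cat => -[mdl].
(* The part of [m] beyond the first block becomes the prefix, and only [d] remains to be pumped. *)
have [||ss [s1 s2 s3 s4 [s5 s6]]] := IH m' [::] [::] d e eqd; rewrite ?cats0 //.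
exists (q :: ss); rewrite !resize_cons !blocks_cons /= s1 s2 ?size_cat ?size_nseq.
split=> //; [by rewrite leq_add2l | by rewrite s4 andbT; lia | rewrite -s5 -s6 lE /=].
have -> : p + q + r - q = p + r by lia.
have -> : p + q + r + q = p + q + q + r by lia.
by rewrite !nseqD -!catA.
Qed.

End Blocks.

(** * Words whose blocks alternate between two letters *)

Section Zigzag.
Variables (T : Type) (g : bool -> T).

(** With [g] as a parameter, the same lengths serve for words over the generators, over the
    generators with # added, and over x itself. *)
Fixpoint zblocks b (ls : seq nat) : seq (nat * T) :=
  if ls is l :: ls' then (l, g b) :: zblocks (~~ b) ls' else [::].

Definition zigzag b ls := blocks (zblocks b ls).

Lemma zigzag_cons b l ls : zigzag b (l :: ls) = nseq l (g b) ++ zigzag (~~ b) ls.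
Proof. by []. Qed.

Lemma size_zigzag b ls : size (zigzag b ls) = sumn ls.
Proof. by elim: ls b => //= l ls IH b; rewrite zigzag_cons size_cat size_nseq IH. Qed.

End Zigzag.

Lemma map_zigzag (T T' : Type) (g : bool -> T) (h : T -> T') b ls :
  map h (zigzag g b ls) = zigzag (h \o g) b ls.
Proof. by elim: ls b => //= l ls IH b; rewrite !zigzag_cons map_cat map_nseq IH. Qed.

Lemma zigzag_cat (T : Type) (g : bool -> T) b ls ls' :
  zigzag g b (ls ++ ls') = zigzag g b ls ++ zigzag g (b (+) odd (size ls)) ls'.
Proof.
elim: ls b => [|l ls IH] b; first by rewrite addbF.
by rewrite cat_cons !zigzag_cons IH -catA /= addbN addNb.
Qed.

Definition letter (Y : Type) (a : signed Y) (b : bool) : signed Y :=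
  if b then linv a else a.

Lemma linvK (Y : Type) : involutive (@linv Y).
Proof. by case=> y b; rewrite /linv negbK. Qed.

Lemma winv_nseq (Y : Type) l (a : signed Y) : winv (nseq l a) = nseq l (linv a).
Proof. by rewrite /winv map_nseq rev_nseq. Qed.

Lemma winv_zigzag (Y : choiceType) (a : signed Y) b ls :
  winv (zigzag (letter a) b ls) = zigzag (letter a) (b (+) odd (size ls)) (rev ls).
Proof.
elim: ls b => // l ls IH b; rewrite zigzag_cons winv_cat winv_nseq IH.
rewrite rev_cons -cats1 zigzag_cat size_rev zigzag_cons cats0 /=.
by case: b; case: (odd _); rewrite //= linvK.
Qed.

Lemma tapes_cat (A : Type) (w1 w2 : seq (A + A)) :
  tapes (w1 ++ w2) = ((tapes w1).1 ++ (tapes w2).1, (tapes w1).2 ++ (tapes w2).2).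
Proof. by elim: w1 => /= [|[] y w1 ->] //; case: tapes. Qed.

Lemma size_tapes (A : Type) (w : seq (A + A)) :
  size (tapes w).1 + size (tapes w).2 = size w.
Proof. by elim: w => //= -[] y w <- /=; rewrite ?addnS. Qed.

(** * Action of words on an interval by partial injections *)

(* The letter [x] acts as the partial injection [z |-> z + 1] of [0, m] and the
   other letters as the empty map; hence the action of a word depends only on
   its class in the free inverse monoid. *)
Section Walk.
Variables (K : choiceType) (x : K).
Implicit Types (u v w : seq (signed K)).

Definition step m (a : signed K) z :=
  if a.1 != x then None
  else if a.2 then if 0 < z <= m then Some z.-1 else None
  else if z < m then Some z.+1 else None.

Fixpoint walk m w z :=
  if w is a :: w' then obind (walk m w') (step m a z) else Some z.

Lemma walk_cat m u v z : walk m (u ++ v) z = obind (walk m v) (walk m u z).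
Proof. by elim: u z => //= a u IH z; case: step. Qed.

Lemma step_linv m a y z : step m a z = Some y -> step m (linv a) y = Some z.
Proof.
rewrite /step /linv /=; case: ifP => // _; case: a.2 => /=.
  by case: ifP => // /andP [z0 zm] [<-]; rewrite prednK // zm.
by case: ifP => // zm [<-]; rewrite /= zm.
Qed.

Lemma walk_winv m w y z : walk m w z = Some y -> walk m (winv w) y = Some z.
Proof.
elim: w z => [|a w IH] z /=; first by move=> [->].
case E: step => [z'|] //= /IH; rewrite -[a :: w]cat1s winv_cat walk_cat => -> /=.
by rewrite (step_linv E).
Qed.

Lemma walk_idem m u z : walk m (u ++ winv u) z = obind (fun=> Some z) (walk m u z).
Proof. by rewrite walk_cat; case E: walk => [y|] //=; exact: walk_winv. Qed.

(** By [walk_idem], [u ++ winv u] acts as the identity restricted to the domain of [u], and such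
    restrictions commute. *)
Lemma walk_fim m u v : fim_cong u v -> walk m u =1 walk m v.
Proof.
elim=> {u v} [u|u v|//|u v _ IH|u v w _ IH1 _ IH2|u u' v v' _ IH1 _ IH2] z.
- by rewrite catA walk_cat walk_idem; case E: (walk m u z) => //=; rewrite E.
- rewrite catA walk_cat walk_idem [in RHS]catA [in RHS]walk_cat [in RHS]walk_idem.
  by case Eu: (walk m u z); case Ev: (walk m v z); rewrite /= ?walk_idem ?Eu ?Ev.
- by rewrite IH.
- by rewrite IH1 IH2.
- by rewrite !walk_cat IH1; case: walk => //= y; rewrite IH2.
Qed.

(** Within a block the walk is monotone, so only the turning points have to be compared with 0 and
    [m]. *)
Fixpoint heights m (b : bool) z ls :=
  if ls is l :: ls' then
    if b then if l <= z then heights m (~~ b) (z - l) ls' else None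
    else if z + l <= m then heights m (~~ b) (z + l) ls' else None
  else Some z.

Lemma walk_zigzag m b z ls : z <= m ->
  walk m (zigzag (pair x) b ls) z = heights m b z ls.
Proof.
elim: ls b z => // l ls IH b z zm; rewrite zigzag_cons /=.
elim: l z zm => [|l IHl] z zm /=.
  by rewrite subn0 addn0 zm IH //; case: b.
rewrite /step /= eqxx /=; case: b IHl => IHl.
  case: z zm => //= z zm; rewrite zm /= IHl ?subSS //; exact: ltnW.
by case: ifP => zm' /=; rewrite ?IHl // ?addnS ?addSn // ifF //; lia.
Qed.

Lemma walk_le m w y z : walk m w z = Some y -> z <= m -> y <= m.
Proof.
elim: w z => [|a w IH] z /=; first by move=> [->].
case E: step => [z'|] //= /IH {}IH zm; apply: IH; move: E; rewrite /step.
by do 3?case: ifP => //; move=> h _ _ [<-] || move=> h _ [<-]; lia.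
Qed.

Lemma step_edge a z z' : step 1 a z = Some z' -> z <= 1 ->
  a = (x, z == 1) /\ z' = 1 - z.
Proof.
case: a => a b; rewrite /step /=; case: eqP => // -> /=.
by case: b; case: z => [|[|z]] //= [<-].
Qed.

(* On the edge {0, 1}, [(x, z == 1)] leaves the vertex [z] and [(x, z == 0)]
   enters it. *)
Lemma walk_edge u z y : walk 1 u z = Some y -> z <= 1 ->
  fim_cong ((x, z == 0) :: u)
           ((x, z == 0) :: (if z == y then [::] else [:: (x, z == 1)])).
Proof.
elim: u z => [|a u IH] z.
  by move=> [->] _; rewrite eqxx; exact: FimRefl.
rewrite [walk _ _ _]/=; case E: step => [z'|] //= walk_u z1.
have [-> z'E] := step_edge E z1; subst z'.
have := IH _ walk_u (leq_subr _ _).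
have -> : (1 - z == 0) = (z == 1) by case: z z1 {E walk_u} => [|[|]].
have -> : (1 - z == 1) = (z == 0) by case: z z1 {E walk_u} => [|[|]].
move=> /(FimCat (FimRefl [:: (x, z == 0)])) /FimTrans; apply => /=.
have y1 := walk_le walk_u (leq_subr _ _).
have -> : (1 - z == y) = ~~ (z == y).
  by case: z y z1 y1 {IH E walk_u} => [|[|]] // [|[|]].
case: (z =P y) => _ /=; last exact: FimRefl.
apply: FimSym; have := FimReg [:: (x, z == 0)].
suff -> : (x, z == 1) = linv (x, z == 0) by [].
by rewrite /linv /=; case: z z1 {E walk_u} => [|[|]].
Qed.

(** The first letter already crosses the edge; the rest is a closed walk, which that letter absorbs
    by [walk_edge]. *)
Lemma walk_edge_cross u z y : walk 1 u z = Some y -> z <= 1 -> z != y ->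
  fim_cong u [:: (x, z == 1)].
Proof.
case: u => [|a u] /=; first by move=> [->]; rewrite eqxx.
case E: step => [z'|] //= walk_u z1 zy.
have [-> z'E] := step_edge E z1; subst z'.
have := walk_edge walk_u (leq_subr _ _).
have y1 := walk_le walk_u (leq_subr _ _).
have -> : (1 - z == 0) = (z == 1) by case: z z1 {E walk_u zy} => [|[|]].
by rewrite ifT //; case: z y z1 y1 zy {E walk_u} => [|[|]] // [|[|]].
Qed.

End Walk.

(** * Every generating set contains x or its inverse *)

Section Generators.
Local Open Scope quotient_scope.
Variables (K : choiceType) (X : {fset FIM K}) (x : K).
Local Notation ev := (weval (M := FIM K) (val : X -> FIM K)).
Local Notation lev := (leval (M := FIM K) (val : X -> FIM K)).

Lemma weval_reprs (w : seq (signed X)) :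
  ev w = \pi_(FIM K) (flatten [seq repr (lev a) | a <- w]).
Proof.
elim: w => //= a w IH.
by rewrite -FIM_piM -IH reprK.
Qed.

Lemma leval_linv a : lev (linv a) = ((lev a)^-1)%g.
Proof. by rewrite /leval /=; case: a.2; rewrite ?invgK. Qed.

(** Some generator in [w] must be the first to change the vertex, and [walk_edge_cross] applies to
    its representative. *)
Lemma crossing_letter (w : seq (signed X)) z y :
  walk x 1 (flatten [seq repr (lev a) | a <- w]) z = Some y -> z <= 1 -> z != y ->
  exists a b, lev a = \pi_(FIM K) [:: (x, b)].
Proof.
elim: w z => [|a w IH] z /=; first by move=> [->]; rewrite eqxx.
rewrite walk_cat; case E: walk => [z'|] //= walk_w z1.
have [e|zz' _] := eqVneq z z'; first by subst z'; exact: IH walk_w z1.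
exists a, (z == 1); rewrite -[LHS]reprK; apply/FIM_eqP.
exact: walk_edge_cross E z1 zz'.
Qed.

Lemma generates_letter : generates X ->
  exists a : signed X, lev a = \pi_(FIM K) [:: (x, false)].
Proof.
move=> /(_ (\pi_(FIM K) [:: (x, false)])) [w].
rewrite weval_reprs => /FIM_eqP /(@walk_fim _ x 1) /(_ 0).
rewrite /= /step /= eqxx /= => /crossing_letter [] // a [[|] ea]; last by exists a.
by exists (linv a); rewrite leval_linv ea FIM_piV.
Qed.

Lemma weval_zigzag a b ls : lev a = \pi_(FIM K) [:: (x, false)] ->
  ev (zigzag (letter a) b ls) = \pi_(FIM K) (zigzag (pair x) b ls).
Proof.
move=> ea; have eb c : lev (letter a c) = \pi_(FIM K) [:: (x, c)].
  by case: c; rewrite //= leval_linv ea FIM_piV.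
elim: ls b => // l ls IH b; rewrite !zigzag_cons.
elim: l => [|l IHl]; first exact: IH.
by rewrite /= IHl eb FIM_piM.
Qed.

End Generators.

(** * Rigidity of the equation U = V under pumping *)

Definition pumped (op : nat -> nat -> nat) (ls ss : seq nat) :=
  [seq op p.1 p.2 | p <- zip ls ss].

Lemma resize_zblocks (T : Type) (g : bool -> T) b op ls ss :
  blocks (resize op (zblocks g b ls) ss) = zigzag g b (pumped op ls ss).
Proof.
elim: ls b ss => [|l ls IH] b [|s ss] //; rewrite /= resize_cons blocks_cons IH.
by rewrite /pumped /= zigzag_cons.
Qed.

Definition up_down n := [:: n; n.*2].
Definition down_up n := [:: n; n.*2; n.*2; n.*2; n.*2].

Lemma zigzag_rigid (K : choiceType) (x : K) n ss ts : 0 < n ->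
  all2 (fun l s => s <= l) (up_down n) ss ->
  all2 (fun l s => s <= l) (down_up n) ts ->
  count (fun t => 0 < t) ts <= 2 ->
  fim_cong (zigzag (pair x) false (pumped subn (up_down n) ss))
           (zigzag (pair x) true (pumped subn (down_up n) ts)) ->
  fim_cong (zigzag (pair x) false (pumped addn (up_down n) ss))
           (zigzag (pair x) true (pumped addn (down_up n) ts)) ->
  sumn ss + sumn ts = 0.
Proof.
move=> n0.
case: ss => [|s1 [|s2 [|]]] //=; rewrite ?andbF // andbT => /andP [s1n s2n].
case: ts => [|t0 [|t1 [|t2 [|t3 [|t4 [|]]]]]] //=; rewrite ?andbF // andbT.
move=> /and5P [t0n t1n t2n t3n t4n] few.
(* Choose the interval [0, m] to be exactly the range of U: it starts at height
   d, peaks at m and ends at y; z1, ..., z4 are the turning points of V.  Below,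
   primed variables describe the words pumped up. *)
have range p1 p2 q0 q1 q2 q3 q4 : fim_cong (zigzag (pair x) false [:: p1; p2])
    (zigzag (pair x) true [:: q0; q1; q2; q3; q4]) ->
    exists m d y z1 z2 z3 z4,
    [/\ d + p1 = m, y + p2 = m, d = 0 \/ y = 0,
        [/\ z1 + q0 = d, z1 + q1 = z2 & z2 <= m]
      & [/\ z3 + q2 = z2, z3 + q3 = z4, z4 <= m & y + q4 = z4]].
  (* With truncated subtraction, [p2 - p1] is the lowest start from which U stays nonnegative, and
     [p2 - p1 + p1] is the maximum of [p1] and [p2]. *)
  move=> /(@walk_fim _ x (p2 - p1 + p1)) /(_ (p2 - p1)).
  rewrite !walk_zigzag ?leq_addr //= leqnn ifT; last by lia.
  move=> /esym; do 5!case: ifP => // ?.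
  move=> [yE]; set d := p2 - p1 in yE *.
  exists (d + p1), d, (d + p1 - p2), (d - q0), (d - q0 + q1), (d - q0 + q1 - q2),
    (d - q0 + q1 - q2 + q3).
  by split=> //; try split=> //; lia.
rewrite /pumped /= => /range [m [d [y [z1 [z2 [z3 [z4 [e1 e2 e3 [e4 e5 e6] [e7 e8 e9 e10]]]]]]]]].
move=> /range [m' [d' [y' [z1' [z2' [z3' [z4' [f1 f2 f3 [f4 f5 f6] [f7 f8 f9 f10]]]]]]]]].
(* The first peak of V is at most [m]. Pumping down and pumping up give opposite inequalities, so
   this peak is exactly at the top both times; the same then follows for the second peak. *)
have t1_ge : t0 + s1 <= t1 by clear - s1n t0n t1n e1 e4 e5 e6; lia.
have t1_le : t1 <= t0 + s1 by clear - f1 f4 f5 f6; lia.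
have t3_ge : t2 <= t3.
  by clear - s1n t0n t1n t2n t3n e1 e4 e5 e7 e8 e9 t1_le; lia.
have t3_le : t3 <= t2 by clear - f1 f4 f5 f7 f8 f9 t1_ge; lia.
(* The last descents of U and V both lead from the top to the common end. *)
have t4E : t4 = s2 by clear - f1 f2 f4 f5 f7 f8 f10 t3_ge t3_le t1_le t1_ge; lia.
(* Pumped up, V first descends by at least [n > 0], so [d'] is positive and [y' = 0]. The two
   valleys [z1'] and [z3'] being nonnegative gives this bound and the next. *)
have s2_ge : s1 + t0 <= s2 by clear - n0 f1 f2 f3 f4; lia.
have t2_le : t2 <= s2 by clear - n0 f1 f2 f3 f4 f5 f7 t1_le t1_ge; lia.
(* Pumping down could erase the first descent; if [t0 = 0] it still has length [n], which forces
   [y = 0], and [z3] being nonnegative gives the reverse bound. *)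
have t2_ge : t0 = 0 -> s2 <= t2.
  by clear - n0 s1n s2n t0n t1n t2n e1 e2 e3 e4 e5 e7 t1_le t1_ge; lia.
clear - few t1_ge t1_le t3_ge t3_le t4E s2_ge t2_le t2_ge.
(* If [t0 > 0], then [t0], [t1] and [t4] are three changed blocks of V; if [t2 > 0], then [t2], [t3]
   and [t4] are. *)
case: (posnP t0) few => [t00|t0p] few; last by lia.
have {t2_ge}t2_ge := t2_ge t00.
by case: (posnP t2) few => [t20|t2p] few; lia.
Qed.

(** * The identity U = V in the free inverse monoid *)

Section UpDown.
Variables (K : choiceType) (x : K).
Local Open Scope quotient_scope.
Local Open Scope group_scope.

(* With e = a^-1 a and f = a a^-1 for a = x^n, the right-hand side is
   e f e f a^-1 = f e a^-1 = f a^-1. *)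
Lemma up_down_eq n :
  \pi_(FIM K) (zigzag (pair x) false (up_down n)) =
  \pi_(FIM K) (zigzag (pair x) true (down_up n)).
Proof.
rewrite /zigzag /blocks /= -!addnn !nseqD -!FIM_piM.
have -> : \pi_(FIM K) (nseq n (x, true)) = (\pi_(FIM K) (nseq n (x, false)))^-1.
  by rewrite FIM_piV winv_nseq.
set a := \pi_(FIM K) (nseq n (x, false)).
have -> : \pi_(FIM K) [::] = 1 by [].
have ff : a * a^-1 * (a * a^-1) = a * a^-1 by rewrite mulgA fim_regular.
have ef := fim_comm a a^-1; rewrite invgK in ef.
have ea : a^-1 * a * a^-1 = a^-1 by have := fim_regular a^-1; rewrite invgK.
rewrite !mulg1 -!mulgA; symmetry.
transitivity ((a^-1 * a) * (a * a^-1) * ((a^-1 * a) * (a * a^-1) * a^-1)).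
  by rewrite -!mulgA.
rewrite -ef -!mulgA (mulgA a^-1 a a^-1) ea.
transitivity (a * a^-1 * (a^-1 * a) * (a * a^-1 * a^-1)); first by rewrite -!mulgA.
rewrite ef -mulgA (mulgA (a * a^-1) (a * a^-1)) ff.
by rewrite (mulgA (a^-1 * a)) -ef -(mulgA (a * a^-1)) ea mulgA.
Qed.

End UpDown.

(** * Neither word problem is context-free *)

(** Here [k] is the number of symbols # left after pumping, since a pumped factor might contain the
    separator. *)
Lemma map_Some_None_inj (T : eqType) k (u v u' v' : seq T) :
  map Some u ++ nseq k None ++ map Some v = map Some u' ++ None :: map Some v' ->
  [/\ k = 1, u = u' & v = v'].
Proof.
have Some_injective : injective (@Some T) by move=> ? ? [].
have inj := inj_map Some_injective.
have noneF w : (None : option T) \in map Some w = false by elim: w.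
elim: u u' => [|y u IH] [|y' u'] //=.
- case: k => [|[|k]] /=.
  + by move=> e; have := noneF v; rewrite e in_cons eqxx.
  + by move=> [/inj].
  + by move=> [e]; have := noneF v'; rewrite -e in_cons eqxx.
- case: k => //= e.
  by have := noneF v; rewrite e in_cons mem_cat in_cons eqxx !orbT.
- by move=> [-> /IH [-> -> ->]].
Qed.

Section NotContextFree.
Variables (K : choiceType) (X : {fset FIM K}) (x : K) (a : signed X).
Local Open Scope quotient_scope.
Hypothesis aE : leval (M := FIM K) (val : X -> FIM K) a = \pi_(FIM K) [:: (x, false)].
Local Notation ev := (weval (M := FIM K) (val : X -> FIM K)).
Local Notation U := (zigzag (letter a) false).
Local Notation V := (zigzag (letter a) true).

Lemma eval_up_down n : ev (U (up_down n)) = ev (V (down_up n)).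
Proof. by rewrite !(weval_zigzag _ _ aE) up_down_eq. Qed.

Lemma eval_rigid n ss ts : 0 < n ->
  all2 (fun l s => s <= l) (up_down n) ss ->
  all2 (fun l s => s <= l) (down_up n) ts ->
  count (fun t => 0 < t) ts <= 2 ->
  ev (U (pumped subn (up_down n) ss)) = ev (V (pumped subn (down_up n) ts)) ->
  ev (U (pumped addn (up_down n) ss)) = ev (V (pumped addn (down_up n) ts)) ->
  sumn ss + sumn ts = 0.
Proof.
move=> n0 ssn tsn few; rewrite !(weval_zigzag _ _ aE) => /FIM_eqP eqB /FIM_eqP eqD.
exact: zigzag_rigid ssn tsn few eqB eqD.
Qed.

Lemma all2_zblocks (T : Type) (g : bool -> T) b ls ss :
  all2 (fun (p : nat * T) s => s <= p.1) (zblocks g b ls) ss =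
  all2 (fun l s => s <= l) ls ss.
Proof. by elim: ls b ss => [|l ls IH] b [|s ss] //=; rewrite IH. Qed.

Lemma inord_inj n i j : i <= n -> j <= n -> inord i = inord j :> 'I_n.+1 -> i = j.
Proof. by move=> ii jj /(congr1 val); rewrite /= !inordK. Qed.

Lemma WP_not_context_free : ~ context_free (@WP (FIM K) X).
Proof.
move=> [G GP].
pose n := (max_rhs G).+1 ^ #|{: nonterm G * 'I_9 * 'I_9}|.
have n0 : 0 < n by rewrite expn_gt0.
pose g b := Some (letter a b).
(* V has five blocks, an odd number, so its formal inverse starts in direction [false], with the
   lengths reversed. The eight blocks give nine indices, hence the colours ['I_9]. *)
pose bs := zblocks g false (up_down n) ++ (1, None) :: zblocks g false (rev (down_up n)).
have blocksE op s1 s2 k t0 t1 t2 t3 t4 :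
  blocks (resize op bs [:: s1; s2; k; t4; t3; t2; t1; t0]) =
  map Some (U (pumped op (up_down n) [:: s1; s2])) ++ nseq (op 1 k) None ++
  map Some (winv (V (pumped op (down_up n) [:: t0; t1; t2; t3; t4]))).
  by rewrite winv_zigzag !map_zigzag /zigzag /blocks /= -!catA.
have bs_WP : cfg_lang G (blocks bs).
  apply/GP; exists (U (up_down n)), (V (down_up n)); split; first exact: eval_up_down.
  by rewrite winv_zigzag !map_zigzag /zigzag /blocks /= -!catA.
have [|e1 [e2 [e3 [e4 [e5 [eW nz c1 c2 [sub add]]]]]]] :=
  pumping (fun p => inord (block_index bs p) : 'I_9) _ bs_WP.
  rewrite /blocks /= !size_cat !size_nseq; lia.
have idx p : block_index bs p <= 8 by exact: block_index_le.
have [ss [s1 s2 s3 s4 [s5 s6]]] := blocks_pump eW (inord_inj (idx _) (idx _) c1)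
  (inord_inj (idx _) (idx _) c2).
move: s1; rewrite size_cat /= => s1.
move: ss s1 s2 s3 s4 s5 s6.
case=> [|u1 [|u2 [|k [|t4 [|t3 [|t2 [|t1 [|t0 [|]]]]]]]]] // _ sums few le_ss.
rewrite !blocksE => s5 s6.
have WP_inv op : cfg_lang G
    (map Some (U (pumped op (up_down n) [:: u1; u2])) ++ nseq (op 1 k) None ++
     map Some (winv (V (pumped op (down_up n) [:: t0; t1; t2; t3; t4])))) ->
    op 1 k = 1 /\ ev (U (pumped op (up_down n) [:: u1; u2])) =
                  ev (V (pumped op (down_up n) [:: t0; t1; t2; t3; t4])).
  move=> /GP [u [v [evE /map_Some_None_inj [-> -> /(congr1 (@winv _))]]]].
  by rewrite !winvK => ->.
move: sub add; rewrite s5 s6 => /WP_inv [_ evB] /WP_inv [k1 evD].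
have k0 : k = 0 by lia.
move: le_ss few sums => /=; rewrite k0.
move=> /and5P [le_u1 le_u2 _ le_t4 /and5P [le_t3 le_t2 le_t1 le_t0 _]] few sums.
have few2 : count (fun t => 0 < t) [:: t0; t1; t2; t3; t4] <= 2.
  have lt2 : (0 < size e2) + (0 < size e4) <= 2 by case: (0 < _); case: (0 < _).
  by move: few lt2 => /=; clear; lia.
have := eval_rigid n0 (_ : all2 _ _ [:: u1; u2]) (_ : all2 _ _ [:: t0; t1; t2; t3; t4])
  few2 evB evD.
rewrite /= le_u1 le_u2 le_t0 le_t1 le_t2 le_t3 le_t4 => /(_ isT isT).
move: nz; rewrite -sums /=; clear; lia.
Qed.

Lemma two_tape_WP_not_context_free : ~ context_free_rel (@two_tape_WP (FIM K) X).
Proof.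
move=> [L [G GP] LP].
pose n := (max_rhs G).+1 ^ #|{: nonterm G * ('I_3 * 'I_6) * ('I_3 * 'I_6)}|.
have n0 : 0 < n by rewrite expn_gt0.
pose bu := zblocks (letter a) false (up_down n).
pose bv := zblocks (letter a) true (down_up n).
have [w Lw tw] := (LP _ _).1 (eval_up_down n).
(* The order in which [w] interleaves U and V is unknown, so a position is coloured by the blocks in
   which both tape heads stand. A factor with equally coloured ends then stays in one block on each
   tape. *)
pose c p : 'I_3 * 'I_6 := (inord (block_index bu (size (tapes (take p w)).1)),
                           inord (block_index bv (size (tapes (take p w)).2))).
have [||e1 [e2 [e3 [e4 [e5 [eW nz c1 c2 [sub add]]]]]]] := @pumping _ G _ c w.
- rewrite -(size_tapes w) tw !size_zigzag /=; lia.
- exact/GP.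
have idu p : block_index bu p <= 2 by exact: block_index_le.
have idv p : block_index bv p <= 5 by exact: block_index_le.
have cE (u v : seq (signed X + signed X)) : w = u ++ v -> c (size u) =
    (inord (block_index bu (size (tapes u).1)), inord (block_index bv (size (tapes u).2))).
  by move=> e; rewrite /c e take_size_cat.
rewrite (cE _ _ eW) (cE _ (e3 ++ e4 ++ e5)) -?catA // in c1.
rewrite (cE _ (e4 ++ e5)) -?catA // (cE _ e5) -?catA // in c2.
move: c1 => [/inord_inj - /(_ (idu _) (idu _)) u1 /inord_inj - /(_ (idv _) (idv _)) v1].
move: c2 => [/inord_inj - /(_ (idu _) (idu _)) u2 /inord_inj - /(_ (idv _) (idv _)) v2].
rewrite !tapes_cat /= in u1 u2 v1 v2.
move: tw; rewrite eW !tapes_cat /= => -[eU eV].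
have [ss [s1 s2 s3 s4 [s5 s6]]] := blocks_pump (esym eU) u1 u2.
have [ts [t1 t2 t3 t4 [t5 t6]]] := blocks_pump (esym eV) v1 v2.
rewrite all2_zblocks in s4; rewrite all2_zblocks in t4.
have evB : ev (U (pumped subn (up_down n) ss)) = ev (V (pumped subn (down_up n) ts)).
  by apply/LP; exists (e1 ++ e3 ++ e5); rewrite ?GP // !tapes_cat /= s5 t5 !resize_zblocks.
have evD : ev (U (pumped addn (up_down n) ss)) = ev (V (pumped addn (down_up n) ts)).
  apply/LP; exists (e1 ++ e2 ++ e2 ++ e3 ++ e4 ++ e4 ++ e5); first exact/GP.
  by rewrite !tapes_cat /= s6 t6 !resize_zblocks.
have few : count (fun t => 0 < t) ts <= 2.
  by apply: leq_trans t3 _; case: (0 < _); case: (0 < _).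
have sum0 := eval_rigid n0 s4 t4 few evB evD.
(* Every letter of [e2 ++ e4] lies on one of the tapes, so the two sums account for its whole
   length. *)
by move: nz; rewrite -size_tapes tapes_cat /= -s2 -t2 sum0.
Qed.

End NotContextFree.

Theorem theorem1 (k : nat) (hk : 1 <= k) (X : {fset FIM 'I_k})
    (hX : generates X) :
  ~ context_free (@WP (FIM 'I_k) X) /\
  ~ context_free_rel (@two_tape_WP (FIM 'I_k) X).
Proof.
have [a aE] := generates_letter (Ordinal hk) hX.
by split; [exact: WP_not_context_free aE | exact: two_tape_WP_not_context_free aE].
Qed.
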